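(* For an indeterminate Stieltjes moment problem the properties (ac) and (aci) are equivalent.
   Context: Let $\nu$ be a probability measure on $[0,\infty)$ with infinite support and moments $s_n=\int_0^\infty t^n\,d\nu(t)$ of every order $n\ge0$. The Stieltjes problem is indeterminate if there are measures on $[0,\infty)$ different from $\nu$ with the same moments. Let $P_n(x)=\sum_{k=0}^n b_{k,n}x^k$ be the orthonormal polynomials of $\nu$ (positive leading coefficients). In the indeterminate case $K(z,w)=\sum_{n=0}^\infty P_n(z)P_n(w)$ is an entire function of two variables; write $K(z,w)=\sum_{j,k\ge0}a_{j,k}z^jw^k$; one has $a_{k,l}=\sum_{n\ge\max(k,l)}b_{k,n}b_{l,n}$ (absolutely convergent). Property (ac): for all $i,j\ge0$ the series $\sum_{k=0}^\infty a_{i,k}s_{k+j}$ is absolutely convergent. Property (aci): (ac) holds and $\sum_{k=0}^\infty a_{i,k}s_{k+j}=\delta_{i,j}$ for all $i,j\ge0$. *)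

(* Defs.v *)
From HB Require Import structures.
From mathcomp Require Import all_boot all_order all_algebra.
From mathcomp Require Import complex.
From mathcomp Require Import all_classical all_reals all_analysis.

Set Implicit Arguments.
Unset Strict Implicit.
Unset Printing Implicit Defensive.

Import Order.TTheory GRing.Theory Num.Theory numFieldNormedType.Exports.

Local Open Scope classical_set_scope.
Local Open Scope ring_scope.
Local Open Scope complex_scope.

Section StieltjesMoments.
Variable R : realType.
Implicit Types (mu nu : {measure set (measurableTypeR R) -> \bar R})
  (s : nat -> R) (P : nat -> {poly R}) (a : nat -> nat -> R).

(* A measure on [0, +oo[ is encoded as a Borel measure on the real line that
   does not charge ]-oo, 0[. *)
Definition on_half_line mu : Prop := mu [set x | x < 0] = 0%E.

Definition has_moments mu s : Prop :=
  forall n, mu.-integrable setT (fun x => (x ^+ n)%:E) /\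
            (\int[mu]_x (x ^+ n)%:E = (s n)%:E)%E.

Definition stieltjes_solution s mu : Prop :=
  on_half_line mu /\ has_moments mu s.

Definition indeterminate s nu : Prop :=
  exists mu, stieltjes_solution s mu /\
             exists2 A, measurable A & mu A <> nu A.

Definition measure_support mu : set R :=
  [set x | forall U : set R, open U -> U x -> (0 < mu U)%E].

Definition orthonormal_polynomials nu P : Prop :=
  (forall n, size (P n) = n.+1 /\ 0 < lead_coef (P n)) /\
  (forall m n, (\int[nu]_x ((P m).[x] * (P n).[x])%:E = (m == n)%:R%:E)%E).

Definition ceval (p : {poly R}) (z : R[i]) : R[i] :=
  (map_poly (real_complex R) p).[z].

(* The regular algebra R[i]^o carries the usual topology of the complex
   plane; R[i] itself is not equipped with one. *)
Definition kernel_fun P (z w : R[i]) : R[i]^o :=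
  limn (series (fun n => (ceval (P n) z * ceval (P n) w : R[i]^o))).

(* The double power series with coefficients a converges absolutely to F at
   every point of the product of two complex planes.  Summability being
   required, the order of summation is immaterial; square partial sums are
   used. *)
Definition entire_expansion a (F : R[i] -> R[i] -> R[i]^o) : Prop :=
  forall z w : R[i],
    summable [set: nat * nat]
      (fun jk => (Normc.normc ((a jk.1 jk.2)%:C * z ^+ jk.1 * w ^+ jk.2))%:E) /\
    (fun N => (\sum_(j < N) \sum_(k < N) (a j k)%:C * z ^+ j * w ^+ k
               : R[i]^o)) @ \oo --> F z w.

Definition prop_ac a s : Prop :=
  forall i j, cvgn [normed (series (fun k => a i k * s (k + j)%N))].

Definition prop_aci a s : Prop :=
  prop_ac a s /\
  forall i j, series (fun k => a i k * s (k + j)%N) @ \oo --> ((i == j)%:R : R).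

End StieltjesMoments.

(* Main.v *)
(** The coefficients of P_n alternate in sign, so |P_n(z)| <= |P_n(-|z|)| and
    K converges everywhere once the sums of P_n(-x)^2 are bounded for x > 0.
    For that, compare nu with a second solution mu on the functions
    p(t) / (t + x)^k.  If the two measures agreed for all p and k they would be
    equal, because half lines are limits of polynomials in 1 / (t + x); at the
    first k where they differ, dividing p by t + x expresses p(-x) through
    integrals, so that |p(-x)| is controlled by the L^2 norm of p.

    Comparing coefficients in K(x,t) gives, for t >= 0,
    sum_k a_(i,k) t^k = sum_n b_(i,n) P_n(t).  Under (ac) the left-hand side
    may be integrated against t^j term by term, which gives
    sum_k a_(i,k) s_(k+j); the right-hand side converges in L^2(nu), and
    orthogonality gives the i-th coefficient of t^j. *)

Require Import Defs.
From HB Require Import structures.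
From mathcomp Require Import all_boot all_order all_algebra.
From mathcomp Require Import complex.
From mathcomp Require Import all_classical all_reals all_analysis.
From mathcomp Require Import measurable_realfun ring lra.

Set Implicit Arguments.
Unset Strict Implicit.
Unset Printing Implicit Defensive.

Import Order.TTheory GRing.Theory Num.Theory numFieldNormedType.Exports.

Local Open Scope classical_set_scope.
Local Open Scope ring_scope.

(** * Orthonormal polynomials of a moment functional and the signs of their coefficients *)

Section OrthonormalPolynomials.
Variables (R : realFieldType) (s : nat -> R).
Implicit Types p q : {poly R}.

(** Integration of polynomials seen through the moments alone, hence common to all solutions of the
    moment problem. *)
Definition moment_functional p : R := \sum_(i < size p) p`_i * s i.
Local Notation L := moment_functional.

Lemma moment_functional_widen N p :
  (size p <= N)%N -> L p = \sum_(i < N) p`_i * s i.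
Proof.
move=> pN; rewrite /L (big_ord_widen_cond _ xpredT (fun i => p`_i * s i) pN).
rewrite big_mkcond; apply: eq_bigr => i _ /=.
by case: ltnP => // pi; rewrite nth_default ?mul0r.
Qed.

Lemma moment_functional_is_scalar : scalar L.
Proof.
move=> c p q; pose N := maxn (size p) (size q).
rewrite (moment_functional_widen (N := N)); last first.
  rewrite (leq_trans (size_polyD _ _))// geq_max leq_maxr andbT.
  by rewrite (leq_trans (size_scale_leq _ _)) ?leq_maxl.
rewrite (moment_functional_widen (leq_maxl _ _ : size p <= N)%N).
rewrite (moment_functional_widen (leq_maxr _ _ : size q <= N)%N).
rewrite /= mulr_sumr -big_split; apply: eq_bigr => i _ /=.
by rewrite coefD coefZ mulrDl mulrA.
Qed.

HB.instance Definition _ :=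
  GRing.isLinear.Build R {poly R} R *%R moment_functional moment_functional_is_scalar.

Lemma moment_functionalXn n : L 'X^n = s n.
Proof.
rewrite (moment_functional_widen (N := n.+1)) ?size_polyXn// big_ord_recr /=.
rewrite coefXn eqxx mul1r big1 ?add0r// => i _.
by rewrite coefXn (ltn_eqF (ltn_ord i)) mul0r.
Qed.

Variable P : nat -> {poly R}.
Hypothesis size_P : forall n, size (P n) = n.+1.
Hypothesis lead_P : forall n, 0 < lead_coef (P n).
Hypothesis L_PP : forall m n, L (P m * P n) = (m == n)%:R.

Let coefPn n : 0 < (P n)`_n.
Proof. by have := lead_P n; rewrite lead_coefE size_P. Qed.

(** Induction on [N] cancels the top coefficient with a multiple of [P N]; orthonormality then
    identifies the coefficients. *)
Lemma orthonormal_expansion N p :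
  (size p <= N)%N -> p = \sum_(n < N) L (p * P n) *: P n.
Proof.
move=> pN; suff [c pE] : exists c : nat -> R, p = \sum_(n < N) c n *: P n.
  rewrite {1}pE; apply: eq_bigr => m _; congr (_ *: _).
  rewrite pE mulr_suml linear_sum /= (bigD1 m)//= -scalerAl linearZ /= L_PP.
  rewrite eqxx mulr1 big1 ?addr0// => i im.
  by rewrite -scalerAl linearZ /= L_PP (negbTE (im : (i : nat) != m)) mulr0.
elim: N p pN => [|N IH] p pN.
  by exists (fun=> 0); rewrite big_ord0; apply/eqP; rewrite -size_poly_leq0.
pose d := p`_N / (P N)`_N.
have [|c pE] := IH (p - d *: P N).
  apply/leq_sizeP => j Nj; rewrite coefB coefZ.
  case: (ltngtP N j) Nj => // [Nj _|<- _].
    by rewrite !nth_default ?mulr0 ?subr0 ?size_P// (leq_trans pN).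
  by rewrite divfK ?subrr// gt_eqF.
exists (fun n => if n == N then d else c n).
rewrite big_ord_recr /= eqxx -[LHS](subrK (d *: P N)) {1}pE; congr (_ + _).
by apply: eq_bigr => i _; rewrite (ltn_eqF (ltn_ord i)).
Qed.

(** The Christoffel-Darboux kernel of degree below [n], as a polynomial in its second variable. *)
Definition christoffel_kernel x n : {poly R} :=
  \sum_(m < n) (P m).[x] *: P m.

Lemma size_christoffel_kernel x n : (size (christoffel_kernel x n) <= n)%N.
Proof.
apply: (leq_trans (size_sum _ _ _)); apply/bigmax_leqP => i _.
by rewrite (leq_trans (size_scale_leq _ _))// size_P.
Qed.

Lemma christoffel_reproducing x n p :
  (size p <= n)%N -> L (p * christoffel_kernel x n) = p.[x].
Proof.
move=> pn; rewrite {2}(orthonormal_expansion pn) horner_sum mulr_sumr linear_sum.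
apply: eq_bigr => i _; rewrite hornerZ -scalerAr linearZ /=.
by rewrite mulrC.
Qed.

Lemma horner_christoffel x n :
  (christoffel_kernel x n).[x] = \sum_(m < n) (P m).[x] ^+ 2.
Proof.
by rewrite horner_sum; apply: eq_bigr => i _; rewrite hornerZ.
Qed.

(** Parseval: [L (p ^+ 2)] is the sum of the squares of the coefficients of [p] in the basis [P]. *)
Lemma moment_functional_sqr_gt0 p : p != 0 -> 0 < L (p ^+ 2).
Proof.
move=> p0; have pE := orthonormal_expansion (leqnn (size p)).
have -> : L (p ^+ 2) = \sum_(n < size p) L (p * P n) ^+ 2.
  rewrite expr2 {2}pE mulr_sumr linear_sum; apply: eq_bigr => i _.
  by rewrite -scalerAr linearZ.
rewrite lt_def sumr_ge0 ?andbT => [|i _]; last exact: sqr_ge0.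
apply: contra p0; rewrite psumr_eq0 => [/allP h|i _]; last exact: sqr_ge0.
rewrite pE big1// => i _.
have := h i; rewrite mem_index_enum sqrf_eq0 => /(_ isT)/eqP ->.
by rewrite scale0r.
Qed.

Hypothesis L_ge0 : forall p, (forall x, 0 <= x -> 0 <= p.[x]) -> 0 <= L p.

(** If the value were 0, then [L ('X * p ^+ 2 * ('X - c%:P) ^+ 2)] would be affine in [c] with
    negative slope, yet nonnegative for every [c]. *)
Lemma moment_functional_Xsqr_gt0 p : p != 0 -> 0 < L ('X * p ^+ 2).
Proof.
move=> p0; have Xp0 : 'X * p != 0 by rewrite mulf_neq0 ?polyX_eq0.
have := moment_functional_sqr_gt0 Xp0; set u := L _ => u0.
have v0 : 0 <= L ('X * p ^+ 2).
  by apply: L_ge0 => x x0; rewrite hornerM hornerX horner_exp mulr_ge0 ?sqr_ge0.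
rewrite lt_def v0 andbT; apply/eqP => v0'.
set w := L ('X^3 * p ^+ 2).
have h c : 0 <= w - 2 * c * u.
  have : 0 <= L ('X * p ^+ 2 * ('X - c%:P) ^+ 2).
    apply: L_ge0 => x x0; rewrite hornerM horner_exp hornerM hornerX horner_exp.
    by apply: mulr_ge0; [apply: mulr_ge0 => //|]; exact: sqr_ge0.
  have -> : 'X * p ^+ 2 * ('X - c%:P) ^+ 2 = 'X^3 * p ^+ 2
     - (2 * c) *: ('X * p) ^+ 2 + (c ^+ 2) *: ('X * p ^+ 2).
    rewrite -!mul_polyC !polyCM polyC_natr; ring.
  by rewrite linearD linearB /= !linearZ /= v0' mulr0 addr0 -/u -/w.
(* This [c] makes [w - 2 * c * u] equal to -1. *)
have := h ((w + 1) / (2 * u)).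
have -> : 2 * ((w + 1) / (2 * u)) * u = w + 1 by field; rewrite gt_eqF.
lra.
Qed.

(* With T_n = sum_(m <= n) P_m(0) P_m, the reproducing property gives
   X T_n = A P_(n+1) + B P_n where A and B have the sign of P_n(0). *)
Lemma orthonormal_coef_alternate n k : 0 <= (-1) ^+ (n + k) * (P n)`_k.
Proof.
have P00 : P 0%N = ((P 0%N)`_0)%:P by apply: size1_polyC; rewrite size_P.
elim/ltn_ind: n k => -[_ k|n IH k].
  rewrite P00 coefC; case: eqP => [->|_]; last by rewrite mulr0.
  by rewrite mul1r ltW.
pose T := christoffel_kernel 0 n.+1.
have sT : (size T <= n.+1)%N := size_christoffel_kernel 0 n.+1.
have T0 : T != 0.
  apply/eqP => T0; have := horner_christoffel 0 n.+1.
  rewrite -/T T0 horner0 big_ord_recl /= {1}P00 hornerC => /eqP.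
  rewrite lt_eqF// ltr_pwDl ?exprn_gt0// sumr_ge0// => i _; exact: sqr_ge0.
pose A := L ('X * T * P n.+1); pose B := L ('X * T * P n).
(* ['X * P m] has degree at most [n] and vanishes at 0, the point that [T] reproduces. *)
have L0 m : (m < n)%N -> L ('X * T * P m) = 0.
  move=> mn; rewrite mulrAC christoffel_reproducing ?hornerM ?hornerX ?mul0r//.
  by rewrite mulrC size_mulX -?size_poly_eq0 size_P// ltnS.
have XT : 'X * T = B *: P n + A *: P n.+1.
  rewrite [LHS](orthonormal_expansion (N := n.+2)); last first.
    by rewrite mulrC size_mulX.
  rewrite !big_ord_recr /= big1 ?add0r// => i _.
  by rewrite L0 ?scale0r.
(* Of the terms of one factor [T], only [(P n).[0] *: P n] is not orthogonal to ['X * T]. *)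
have PB : 0 < (P n).[0] * B.
  have := moment_functional_Xsqr_gt0 T0; suff -> : L ('X * T ^+ 2) = (P n).[0] * B by [].
  rewrite expr2 mulrA {2}/T /christoffel_kernel big_ord_recr /= mulrDr linearD /=.
  rewrite -scalerAr linearZ /= mulr_sumr linear_sum /= big1 ?add0r// => i _.
  by rewrite -scalerAr linearZ /= L0 ?mulr0.
have AE : A * (P n.+1)`_n.+1 = (P n).[0] * (P n)`_n.
  have := congr1 (fun p : {poly R} => p`_n.+1) XT => /=.
  rewrite mulrC coefMX coefD !coefZ /= [(P n)`_n.+1]nth_default ?size_P// mulr0 add0r.
  move=> <-; rewrite /T coef_sum big_ord_recr /= coefZ big1 ?add0r// => i _.
  by rewrite coefZ nth_default ?mulr0// size_P.
pose e := (-1) ^+ n * (P n).[0].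
have P0E m : (P m).[0] = (P m)`_0 by rewrite horner_coef0.
have e0 : 0 < e.
  rewrite lt_def; have := IH n (ltnSn n) 0%N; rewrite addn0 -P0E -/e => ->.
  rewrite andbT mulf_neq0 ?signr_eq0//; apply: contraTneq PB => ->.
  by rewrite mul0r ltxx.
have sg m : (-1) ^+ m * (-1) ^+ m = 1 :> R by rewrite -expr2 sqrr_sign.
have A0 : 0 < (-1) ^+ n * A.
  rewrite -(pmulr_lgt0 _ (coefPn n.+1)) -mulrA AE mulrA.
  by rewrite mulr_gt0.
have B0 : 0 < (-1) ^+ n * B.
  by rewrite -(pmulr_rgt0 _ e0) /e mulrACA sg mul1r.
(* Each term of this coefficient is a product of two coefficients of [P i], of degrees 0 and [j];
   their signs multiply to that of [(-1) ^+ j]. *)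
have T_alt j : 0 <= (-1) ^+ j * T`_j.
  rewrite /T coef_sum mulr_sumr sumr_ge0// => i _.
  rewrite coefZ mulrA mulrAC.
  have -> : (-1) ^+ j * (P i)`_j * (P i).[0] =
      ((-1) ^+ (i + 0) * (P i)`_0) * ((-1) ^+ (i + j) * (P i)`_j) :> R.
    rewrite addn0 exprD P0E; transitivity ((-1) ^+ i * (-1) ^+ i *
      ((-1) ^+ j * (P i)`_j * (P i)`_0) : R); first by rewrite sg mul1r.
    by move: ((-1) ^+ i) ((-1) ^+ j) => u v; ring.
  by apply: mulr_ge0; apply: IH; exact: ltn_ord.
rewrite -(pmulr_rge0 _ A0).
have bE : A * (P n.+1)`_k = ('X * T)`_k - B * (P n)`_k.
  by rewrite XT coefD !coefZ addrAC subrr add0r.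
(* In [A *: P n.+1 = 'X * T - B *: P n] the shift by ['X] and the minus sign each absorb one change
   of parity, so two nonnegative terms remain. *)
have -> : (-1) ^+ n * A * ((-1) ^+ (n.+1 + k) * (P n.+1)`_k) =
    (-1) ^+ k.+1 * ('X * T)`_k + (-1) ^+ n * B * ((-1) ^+ (n + k) * (P n)`_k).
  transitivity (((-1) ^+ n * (-1) ^+ n) * - (-1) ^+ k * (A * (P n.+1)`_k)).
    by rewrite !exprD exprS; move: ((-1) ^+ n) ((-1) ^+ k) => u v; ring.
  rewrite bE sg exprD exprS mulrBr mul1r mulN1r; congr (_ + _).
  transitivity (((-1) ^+ n * (-1) ^+ n) * (- (- (-1) ^+ k * (B * (P n)`_k))) : R).
    by rewrite sg mul1r.
  by move: ((-1) ^+ n) ((-1) ^+ k) => u v; ring.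
rewrite addr_ge0//; last by apply: mulr_ge0; [exact: ltW|exact: IH].
rewrite [_ * T]mulrC coefMX; case: k {bE} => [|k]; first by rewrite mulr0.
by rewrite !exprS !mulN1r opprK; apply: T_alt.
Qed.

(** The coefficient of degree [i] has the sign of [(-1) ^+ (n + i)], so at [- y] only the common
    sign [(-1) ^+ n] is left. *)
Lemma horner_orthonormalN n y :
  (P n).[- y] = (-1) ^+ n * \sum_(i < size (P n)) `|(P n)`_i| * y ^+ i.
Proof.
rewrite horner_coef mulr_sumr; apply: eq_bigr => i _.
have -> : `|(P n)`_i| = (-1) ^+ (n + i) * (P n)`_i.
  rewrite -(ger0_norm (orthonormal_coef_alternate n i)).
  by rewrite normrM normrX normrN1 expr1n mul1r.
by rewrite exprD !mulrA -expr2 sqrr_sign mul1r (exprNn y) mulrA [(P n)`_i * _]mulrC.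
Qed.

Lemma norm_horner_orthonormalN n y : 0 <= y ->
  `|(P n).[- y]| = \sum_(i < size (P n)) `|(P n)`_i| * y ^+ i.
Proof.
move=> y0; rewrite horner_orthonormalN normrM normrX normrN1 expr1n mul1r.
by rewrite ger0_norm// sumr_ge0// => i _; rewrite mulr_ge0 ?exprn_ge0.
Qed.

(** At [- y] no cancellation takes place, so the triangle inequality at [x] is bounded by the value
    there. *)
Lemma norm_horner_orthonormal_le n (x y : R) :
  `|x| <= y -> `|(P n).[x]| <= `|(P n).[- y]|.
Proof.
move=> xy; have y0 : 0 <= y := le_trans (normr_ge0 x) xy.
rewrite norm_horner_orthonormalN// horner_coef.
apply: le_trans (ler_norm_sum _ _ _) _; apply: ler_sum => i _.
by rewrite normrM normrX ler_wpM2l// lerXn2r.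
Qed.

Lemma norm_coef_orthonormal_le n k : `|(P n)`_k| <= `|(P n).[-1]|.
Proof.
rewrite norm_horner_orthonormalN//.
have [kn|kn] := ltnP k (size (P n)); last first.
  by rewrite nth_default// normr0 sumr_ge0// => i _; rewrite expr1n mulr1.
by rewrite (bigD1 (Ordinal kn))//= expr1n mulr1 lerDl sumr_ge0.
Qed.

End OrthonormalPolynomials.

(** * Solutions on the half line and their integrals against powers of [1 / (x + t)] *)

Section HalfLineMeasure.
Variables (R : realType) (s : nat -> R)
  (mu : {measure set (measurableTypeR R) -> \bar R}).
Hypothesis mu_s : stieltjes_solution s mu.
Local Notation H := (`[0, +oo[%classic : set (measurableTypeR R)).
Local Notation L := (moment_functional s).

Lemma measurable_half_line : measurable H.
Proof. exact: measurable_itv. Qed.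
Hint Resolve measurable_half_line : core.

Lemma integrable_horner (p : {poly R}) :
  mu.-integrable setT (fun x => (p.[x])%:E).
Proof.
have [_ hm] := mu_s.
under eq_fun do rewrite horner_coef -sumEFin.
apply: integrable_sum => // i _.
under eq_fun do rewrite EFinM.
by apply: integrableZl => //; exact: (hm i).1.
Qed.

Lemma integrable_horner_half_line (p : {poly R}) :
  mu.-integrable H (fun x => (p.[x])%:E).
Proof. exact: integrableS (integrable_horner p). Qed.

Lemma setT_half_lineD : [set: R] `\` [set x | x < 0] = H.
Proof.
apply/seteqP; split => [x [_ /negP]|x]; rewrite /= in_itv /= andbT.
  by rewrite -leNgt.
by rewrite leNgt => /negP.
Qed.

Lemma integral_half_line (f : R -> \bar R) : mu.-integrable setT f ->
  (\int[mu]_x f x = \int[mu]_(x in H) f x)%E.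
Proof.
move=> mf; have [mu0 _] := mu_s.
have mN : measurable ([set x | x < 0] : set (measurableTypeR R)).
  by rewrite -set_itvNyo; exact: measurable_itv.
by rewrite (negligible_integral mN)// setT_half_lineD.
Qed.

Lemma integral_poly_moment (p : {poly R}) : (\int[mu]_x (p.[x])%:E = (L p)%:E)%E.
Proof.
have [_ hm] := mu_s.
under eq_integral do rewrite horner_coef -sumEFin.
rewrite integral_sum//; last first.
  move=> i; under eq_fun do rewrite EFinM.
  by apply: integrableZl => //; exact: (hm i).1.
rewrite /moment_functional -sumEFin; apply: eq_bigr => i _.
under eq_integral do rewrite EFinM.
by rewrite integralZl ?(hm i).2//; exact: (hm i).1.
Qed.

Lemma Rintegral_horner (p : {poly R}) : \int[mu]_(x in H) p.[x] = L p.
Proof.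
by rewrite /Rintegral -integral_half_line ?integral_poly_moment//; exact: integrable_horner.
Qed.

Lemma moment_functional_ge0 (p : {poly R}) :
  (forall x, 0 <= x -> 0 <= p.[x]) -> 0 <= L p.
Proof.
move=> p0; rewrite -Rintegral_horner; apply: Rintegral_ge0 => x.
by rewrite /= in_itv/= andbT => /p0.
Qed.

Lemma measure_setT_moment : mu setT = (s 0%N)%:E.
Proof.
have [_ /(_ 0%N) [_ <-]] := mu_s.
by under eq_integral do rewrite expr0; rewrite integral_cst// mul1e.
Qed.

Variable x : R.
Hypothesis x0 : 0 < x.
(* Equals 1 / (x + t) on the half line; the absolute value makes it continuous
   on the whole line. *)
Definition resolvent (t : R) : R := (x + `|t|)^-1.
Local Notation v := resolvent.

Lemma resolvent_gt0 t : 0 < v t.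
Proof. by rewrite invr_gt0 ltr_wpDr. Qed.

Lemma resolvent_le t : v t <= x^-1.
Proof. by rewrite lef_pV2 ?posrE ?ltr_wpDr// lerDl. Qed.

Lemma continuous_resolvent : continuous v.
Proof.
move=> t; apply: cvgV; first by rewrite gt_eqF// ltr_wpDr.
by apply: cvgD; [exact: cvg_cst|exact: norm_continuous].
Qed.

Lemma measurable_horner_resolvent k (p : {poly R}) (D : set (measurableTypeR R)) :
  measurable D -> measurable_fun D (fun t => p.[t] * v t ^+ k).
Proof.
move=> mD; apply: measurable_funS (measurableT) _ _ => //.
apply: measurable_funM.
  by apply: continuous_measurable_fun; exact: continuous_horner.
by apply: measurable_funX; apply: continuous_measurable_fun; exact: continuous_resolvent.
Qed.

Lemma norm_horner_resolvent_le k (p : {poly R}) t :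
  `|p.[t] * v t ^+ k| <= `|x^-1 ^+ k * p.[t]|.
Proof.
have v0 := ltW (resolvent_gt0 t); have xV : 0 <= x^-1 by rewrite invr_ge0 ltW.
rewrite !normrM mulrC ler_wpM2r//.
rewrite [leLHS]ger0_norm ?exprn_ge0// [leRHS]ger0_norm ?exprn_ge0//.
by rewrite lerXn2r// resolvent_le.
Qed.

Lemma integrable_horner_resolvent k (p : {poly R}) :
  mu.-integrable H (fun t => (p.[t] * v t ^+ k)%:E).
Proof.
apply: (@le_integrable _ _ _ mu H _ _ (fun t => (x^-1 ^+ k *: p).[t]%:E)) => //.
- by apply/measurable_EFinP; exact: measurable_horner_resolvent.
- move=> t _; rewrite lee_fin hornerZ; exact: norm_horner_resolvent_le.
- exact: integrable_horner_half_line.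
Qed.

Definition resolvent_moment k (p : {poly R}) : R :=
  \int[mu]_(t in H) (p.[t] * v t ^+ k).

Lemma resolvent_moment0 p : resolvent_moment 0 p = L p.
Proof.
rewrite -Rintegral_horner; apply: eq_Rintegral => t _.
by rewrite expr0 mulr1.
Qed.

(** On the half line [(t + x) * v t = 1]: the quotient loses one power of the resolvent, and the
    remainder is the constant [p.[- x]]. *)
Lemma resolvent_momentS k (p q : {poly R}) : p = q * ('X + x%:P) + p.[- x]%:P ->
  resolvent_moment k.+1 p =
  resolvent_moment k q + p.[- x] * resolvent_moment k.+1 1.
Proof.
move=> pE; rewrite /resolvent_moment -RintegralZl//; last first.
  exact: integrable_horner_resolvent.
rewrite -RintegralD//; last 2 first.
- exact: integrable_horner_resolvent.
- apply: eq_integrable (integrable_horner_resolvent k.+1 (p.[- x])%:P) => // t _.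
  by rewrite /= !hornerC mul1r.
apply: eq_Rintegral => t; rewrite inE/= in_itv/= andbT => t0.
rewrite {1}pE !hornerE mulrDl; congr (_ + _); last by rewrite /= mulr1.
rewrite exprS -!mulrA; congr (_ * _); rewrite mulrA /v /resolvent ger0_norm//.
by rewrite [t + x]addrC mulfV ?mul1r// gt_eqF// ltr_wpDr.
Qed.

(** From [|p| <= 1 + p ^+ 2] and [v <= 1 / x]. Only moments occur in the bound, so it is the same
    for every solution. *)
Lemma norm_resolvent_moment_le k (p : {poly R}) :
  `|resolvent_moment k p| <= x^-1 ^+ k * (L 1 + L (p ^+ 2)).
Proof.
have x1 : 0 <= x^-1 ^+ k by rewrite exprn_ge0// invr_ge0 ltW.
apply: le_trans (le_normr_Rintegral _ (integrable_horner_resolvent k p)) _ => //.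
rewrite -linearD/= -[leRHS]linearZ/= -Rintegral_horner; apply: le_Rintegral => //.
- by have /integrable_norm := integrable_horner_resolvent k p.
- exact: integrable_horner_half_line.
- move=> t _; apply: le_trans (norm_horner_resolvent_le _ _ _) _.
  rewrite normrM ger0_norm// hornerZ ler_wpM2l// hornerD hornerC horner_exp.
  rewrite -(real_normK (num_real p.[t])).
  have := sqr_ge0 (`|p.[t]| - 1); have := normr_ge0 p.[t]; nra.
Qed.

End HalfLineMeasure.

(** * Approximation of a step function by polynomials on the unit interval *)

Section StepApproximation.
Variable R : realType.
Implicit Types (u r b y : R) (m n : nat).

Lemma bernoulli_ineq u m : -1 <= u -> 1 + m%:R * u <= (1 + u) ^+ m.
Proof.
move=> u1; elim: m => [|m IH]; first by rewrite mul0r addr0 expr0.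
have h : 0 <= 1 + u by lra.
rewrite exprS; apply: le_trans (ler_wpM2l h IH).
rewrite -natr1; have := mulr_ge0 (ler0n R m) (sqr_ge0 u); nra.
Qed.

(** The geometric estimate [n r^n <= 1 + r + ... + r^(n-1)], multiplied by [1 - r]. *)
Lemma natr_mul_expr_le r n : 0 <= r <= 1 -> n%:R * r ^+ n * (1 - r) <= 1 - r ^+ n.
Proof.
move=> /andP[r0 r1]; elim: n => [|n IH]; first by rewrite !mul0r expr0 subrr.
have h0 : 0 <= r ^+ n.+1 by rewrite exprn_ge0.
have h1 : r ^+ n.+1 <= 1 by rewrite exprn_ile1.
have h : 0 <= (1 - r) * (1 - r ^+ n.+1) by rewrite mulr_ge0// subr_ge0.
have := ler_wpM2l r0 IH; move: h0 h1 h; rewrite exprS -natr1.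
set a := r ^+ n; set k := n%:R => h0 h1 h IH'.
have -> : (k + 1) * (r * a) * (1 - r) = r * (k * a * (1 - r)) + r * a * (1 - r) by ring.
nra.
Qed.

(** With [r = q ^+ 2], the factor [n%:R * q ^+ n] is at most [(1 - q)^-1] and the other [q ^+ n]
    tends to 0. *)
Lemma cvg_natr_mul_expr r : 0 <= r < 1 -> (fun n => n%:R * r ^+ n) @ \oo --> (0 : R).
Proof.
move=> /andP[r0 r1]; pose q := Num.sqrt r.
have q0 : 0 <= q := sqrtr_ge0 r.
have q1 : q < 1 by rewrite -sqrtr1 ltr_sqrt.
have qr : q ^+ 2 = r by rewrite sqr_sqrtr.
have q1' : 0 < 1 - q by rewrite subr_gt0.
apply: (@squeeze_cvgr _ _ _ _ (cst 0) (fun n => (1 - q)^-1 * q ^+ n)).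
- near=> n; rewrite /cst/= mulr_ge0 ?exprn_ge0//=.
  rewrite -qr -exprM mulnC muln2 -addnn exprD mulrA ler_wpM2r ?exprn_ge0//.
  rewrite -[leRHS]mul1r ler_pdivlMr// (le_trans (natr_mul_expr_le _ _))//.
    by rewrite q0 ltW.
  by rewrite lerBlDr lerDl exprn_ge0.
- exact: cvg_cst.
- rewrite -[X in _ --> X](mulr0 (1 - q)^-1); apply: cvgMl_tmp.
  by apply: cvg_expr; rewrite ger0_norm.
Unshelve. all: by end_near. Qed.

Definition step_exponent b n : nat := (n * (Num.truncn (b^-1 ^+ n)).+1)%N.

(* The exponent lies between n b^-n and 2 n b^-n: the powers tend to 1 or 0
   according to whether n (y / b)^n tends to 0 or to infinity. *)
Lemma cvg_step b y : 0 < b <= 1 -> 0 <= y <= 1 ->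
  (fun n => (1 - y ^+ n) ^+ step_exponent b n) @ \oo --> ((y < b)%R%:R : R).
Proof.
move=> /andP[b0 b1] /andP[y0 y1].
have bV : 1 <= b^-1 by rewrite invf_ge1.
have yn n : 0 <= y ^+ n <= 1 by rewrite exprn_ge0// exprn_ile1.
have f0 n : 0 <= (1 - y ^+ n) ^+ step_exponent b n.
  by rewrite exprn_ge0// subr_ge0; case/andP: (yn n).
have f1 n : (1 - y ^+ n) ^+ step_exponent b n <= 1.
  rewrite exprn_ile1 ?subr_ge0//; first by case/andP: (yn n).
  by rewrite lerBlDr lerDl; case/andP: (yn n).
have bn1 n : 1 <= b^-1 ^+ n by rewrite exprn_ege1.
case: ltP => [yb|by_].
- have r1 : 0 <= y / b < 1 by rewrite divr_ge0 ?(ltW b0)//= ltr_pdivrMr// mul1r.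
  (* Bernoulli's inequality bounds the power below by 1 minus the exponent times [y ^+ n], and the
     exponent is at most [2 n b^-n]. *)
  apply: (@squeeze_cvgr _ _ _ _ (fun n => 1 - 2 * (n%:R * (y / b) ^+ n)) (cst 1)).
  + near=> n; rewrite f1 andbT.
    have h : -1 <= - y ^+ n by rewrite lerN2; case/andP: (yn n).
    apply: le_trans (bernoulli_ineq (step_exponent b n) h).
    rewrite mulrN lerD2l lerN2 /step_exponent natrM expr_div_n -exprVn.
    have /andP[yn0 _] := yn n.
    have : ((Num.truncn (b^-1 ^+ n)).+1%:R : R) <= 2 * b^-1 ^+ n.
      rewrite -natr1 mulr_natl mulr2n lerD// truncn_le// exprn_ge0//.
      by rewrite invr_ge0 ltW.
    set c := b^-1 ^+ n; set d := _.+1%:R => dc.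
    have := ler_wpM2l (mulr_ge0 (ler0n R n) yn0) dc; lra.
  + rewrite (_ : true%:R = 1 - 2 * 0 :> R); last by rewrite mulr0 subr0.
    apply: cvgB; first exact: cvg_cst.
    by apply: cvgMl_tmp; exact: cvg_natr_mul_expr.
  + exact: cvg_cst.
(* The power times [(1 + y ^+ n) ^+ step_exponent b n] is at most 1, and by Bernoulli this second
   factor is at least [n.+1]. *)
- apply: (@squeeze_cvgr _ _ _ _ (cst 0) harmonic).
  + near=> n; rewrite f0 /= -[leRHS]mul1r ler_pdivlMr//.
    have /andP[yn0 yn1] := yn n.
    have yn0' : -1 <= y ^+ n by rewrite (le_trans _ yn0)// lerN10.
    have h : n.+1%:R <= (1 + y ^+ n) ^+ step_exponent b n.
      apply: le_trans (bernoulli_ineq _ yn0').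
      rewrite -nat1r lerD2l /step_exponent natrM -mulrA ler_peMr//.
      have : b^-1 ^+ n <= (Num.truncn (b^-1 ^+ n)).+1%:R by exact/ltW/truncnS_gt.
      move/(ler_wpM2r yn0); apply: le_trans.
      by rewrite -exprMn exprn_ege1// mulrC ler_pdivlMr// mul1r.
    apply: le_trans (ler_wpM2l (f0 n) h) _; rewrite -exprMn.
    have -> : (1 - y ^+ n) * (1 + y ^+ n) = 1 - (y ^+ n) ^+ 2 by ring.
    rewrite exprn_ile1// ?subr_ge0 ?exprn_ile1//.
    by rewrite lerBlDr lerDl sqr_ge0.
  + exact: cvg_cst.
  + exact: cvg_harmonic.
Unshelve. all: by end_near. Qed.

End StepApproximation.

(** * Resolvent moments determine a solution; two distinct solutions bound point evaluations *)

Section ResolventDeterminacy.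
Variables (R : realType) (s : nat -> R) (x : R).
Hypothesis x0 : 0 < x.
Local Notation H := (`[0, +oo[%classic : set (measurableTypeR R)).
Local Notation L := (moment_functional s).
Local Notation v := (resolvent x).

(** At [v t] with [t >= 0] the step variable is [y = x / (x + t)] and the threshold
    [b = x / (x + c)], so that [y < b] means [c < t]. *)
Definition step_poly c n : {poly R} :=
  (1 - x ^+ n *: 'X^n) ^+ step_exponent (x / (x + c)) n.

Lemma horner_step_poly c n t :
  (step_poly c n).[v t] = (1 - (x * v t) ^+ n) ^+ step_exponent (x / (x + c)) n.
Proof.
rewrite /step_poly horner_exp hornerD hornerN hornerZ hornerXn hornerC.
by rewrite exprMn.
Qed.

Let xv t : 0 <= x * v t <= 1.
Proof.
apply/andP; split; first by rewrite ltW// mulr_gt0// resolvent_gt0.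
by rewrite -(mulfV (lt0r_neq0 x0)) ler_pM2l// resolvent_le.
Qed.

Section OneMeasure.
Variable mu : {measure set (measurableTypeR R) -> \bar R}.
Hypothesis mu_s : stieltjes_solution s mu.

Lemma integral_horner_of_resolvent (q : {poly R}) :
  (\int[mu]_(t in H) (q.[v t])%:E =
   (\sum_(i < size q) q`_i * resolvent_moment mu x i 1)%:E)%E.
Proof.
have int1 k := integrable_horner_resolvent mu_s x0 k 1.
under eq_integral do rewrite horner_coef -sumEFin.
have intv (i : nat) : mu.-integrable H (fun t => (v t ^+ i)%:E).
  by apply: eq_integrable (int1 i) => // t _; rewrite hornerC mul1r.
rewrite integral_sum//; last first.
  by move=> i; exact: (integrableZl (@measurable_half_line R) q`_i (intv i)).
rewrite -sumEFin; apply: eq_bigr => i _.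
apply: etrans (integralZl (@measurable_half_line R) (intv i) q`_i) _.
rewrite EFinM; congr (_ * _)%E.
rewrite /resolvent_moment /Rintegral fineK ?integrable_fin_num//.
by apply: eq_integral => t _; rewrite hornerC mul1r.
Qed.

(** Dominated convergence: the integrands lie between 0 and 1, and constants are integrable because
    the mass is finite. *)
Lemma cvg_integral_step_poly c : 0 <= c ->
  (fun n => \int[mu]_(t in H) ((step_poly c n).[v t])%:E)%E @ \oo
    --> mu `]c, +oo[%classic.
Proof.
move=> c0; have xc : 0 < x + c by rewrite ltr_wpDr.
have b01 : 0 < x / (x + c) <= 1.
  by rewrite divr_gt0//= ler_pdivrMr// mul1r lerDl.
have mI : measurable (`]c, +oo[%classic : set (measurableTypeR R)).
  exact: measurable_itv.
have IH : (`]c, +oo[%classic `&` H) = `]c, +oo[%classic.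
  apply/setIidl => t /=; rewrite !in_itv/= !andbT => ct.
  by rewrite (le_trans c0)// ltW.
have <- : (\int[mu]_(t in H) (\1_(`]c, +oo[%classic : set R) t)%:E = mu `]c, +oo[%classic)%E.
  by rewrite integral_indic//= IH.
have [] := @dominated_convergence _ _ _ mu H (@measurable_half_line R)
  (fun n t => ((step_poly c n).[v t])%:E)
  (fun t => (\1_(`]c, +oo[%classic : set R) t)%:E) (cst 1%:E) _ _ _ _ _ => //.
- move=> n; apply/measurable_EFinP; apply: measurable_funS (measurableT) _ _ => //.
  apply: continuous_measurable_fun => t.
  by apply: continuous_comp; [exact: continuous_resolvent|exact: continuous_horner].
- by apply/measurable_EFinP; exact: measurable_indic.
- apply: aeW => t /=; rewrite in_itv/= andbT => t0; apply/fine_cvgP.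
  split; first exact: nearW.
  under eq_fun do rewrite /= horner_step_poly.
  rewrite indicE mem_setE in_itv/= andbT.
  have -> : (c < t) = (x * v t < x / (x + c)).
    have xt : 0 < x + `|t| by rewrite ltr_wpDr.
    by rewrite /resolvent ltr_pM2l// ltf_pV2 ?posrE// ltrD2l ger0_norm.
  exact: cvg_step.
- have := integrable_horner_half_line mu_s 1.
  by apply: eq_integrable => // t _; rewrite hornerC.
- apply: aeW => t n _; rewrite lee_fin horner_step_poly.
  have /andP[h0 h1] := xv t.
  have g0 : 0 <= 1 - (x * v t) ^+ n by rewrite subr_ge0 exprn_ile1.
  rewrite ger0_norm ?exprn_ge0// exprn_ile1//.
  by rewrite lerBlDr lerDl exprn_ge0.
Qed.

End OneMeasure.

Variables mu nu : {measure set (measurableTypeR R) -> \bar R}.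
Hypotheses (mu_s : stieltjes_solution s mu) (nu_s : stieltjes_solution s nu).

(** Open half lines form a pi-system generating the Borel sets, and those of finite mass cover the
    line, so agreement on them suffices; step polynomials in the resolvent supply it. *)
Lemma eq_measure_resolvent_moment :
  (forall k, resolvent_moment mu x k 1 = resolvent_moment nu x k 1) ->
  forall A, measurable A -> mu A = nu A.
Proof.
move=> eqm.
have eqI c : 0 <= c -> mu `]c, +oo[%classic = nu `]c, +oo[%classic.
  move=> c0; have hm := cvg_integral_step_poly mu_s c0.
  have hn := cvg_integral_step_poly nu_s c0.
  apply: (cvg_unique _ hm); first exact: ereal_hausdorff.
  suff -> : (fun n => \int[mu]_(t in H) ((step_poly c n).[v t])%:E)%E =
            (fun n => \int[nu]_(t in H) ((step_poly c n).[v t])%:E)%E by [].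
  apply/funext => n; rewrite (integral_horner_of_resolvent mu_s).
  rewrite (integral_horner_of_resolvent nu_s).
  by congr (_%:E); apply: eq_bigr => i _; rewrite eqm.
have eqG A : RGenOInfty.G A -> mu A = nu A.
  case=> c ->; have [c0|c0] := leP 0 c; first exact: eqI.
  (* For [c < 0] the half line carries the whole mass [s 0]. *)
  have h (m : {measure set (measurableTypeR R) -> \bar R}) :
      stieltjes_solution s m -> m `]c, +oo[%classic = (s 0%N)%:E.
    move=> m_s; rewrite -(measure_setT_moment m_s); have [m0 _] := m_s.
    have mN : measurable ([set t | t < 0] : set (measurableTypeR R)).
      by rewrite -set_itvNyo; exact: measurable_itv.
    have mI : measurable (`]c, +oo[%classic : set (measurableTypeR R)).
      exact: measurable_itv.
    rewrite (measureDI m measurableT mI) [X in (X + _)%E](_ : _ = 0%E).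
      by rewrite add0e setTI.
    apply: (subset_measure0 _ mN _ m0); first exact: measurableD.
    move=> t [_ /=]; rewrite in_itv/= andbT => /negP.
    by rewrite -leNgt => /le_lt_trans; exact.
  by rewrite (h _ mu_s) (h _ nu_s).
move=> A mA; apply: (@measure_unique _ R (measurableTypeR R) (@RGenOInfty.G R)
  (fun n => `]- n%:R, +oo[%classic) _ _ _ _ mu nu) => //.
- exact: RGenOInfty.measurableE.
- move=> _ _ [a ->] [b ->]; exists (Num.max a b).
  apply/seteqP; split => t /=; rewrite !in_itv/= !andbT gt_max.
    by case=> -> ->.
  by move/andP.
- by move=> n; exists (- n%:R).
- apply/seteqP; split => // t _; exists (Num.truncn (- t)).+1 => //=.
  by rewrite in_itv/= andbT ltrNl truncnS_gt.
- move=> n; have mn : measurable (`]- n%:R, +oo[%classic : set (measurableTypeR R)).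
    exact: measurable_itv.
  apply: le_lt_trans (le_measure mu (mem_set mn) (mem_set measurableT) (@subsetT _ _)) _.
  by have := measure_setT_moment mu_s => /= ->; rewrite ltry.
Qed.

(* If the integrals against v^k agree for all polynomials but those against
   v^(k+1) do not, synthetic division shows that p(-x) times their defect
   on 1 is the defect on p. *)
Lemma point_evaluation_bound A : measurable A -> mu A <> nu A ->
  exists2 C, 0 < C & forall p : {poly R}, `|p.[- x]| <= C * (L 1 + L (p ^+ 2)).
Proof.
move=> mA neqA.
pose I m k p := @resolvent_moment R m x k p.
pose d k := I mu k 1 - I nu k 1.
apply: contrapT => nC.
(* Without a bound every defect [d k.+1] must vanish, so all these integrals agree and the measures
   coincide. *)
have eqI k p : I mu k p = I nu k p.
  elim: k p => [|k IH] p.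
    by rewrite /I (resolvent_moment0 mu_s) (resolvent_moment0 nu_s).
  have dE r : I mu k.+1 r - I nu k.+1 r = r.[- x] * d k.+1.
    have /factor_theorem[q rE] : root (r - r.[- x]%:P) (- x).
      by rewrite /root hornerD hornerN hornerC subrr.
    rewrite polyCN opprK in rE.
    have rE' : r = q * ('X + x%:P) + r.[- x]%:P by rewrite -rE subrK.
    rewrite /I (resolvent_momentS mu_s x0 _ rE') (resolvent_momentS nu_s x0 _ rE').
    have := IH q; rewrite /I /d /I => ->; ring.
  apply/eqP; rewrite -subr_eq0 dE mulf_eq0; apply/orP; right.
  apply: contra_notT nC => d0.
  have d0' : 0 < `|d k.+1| by rewrite normr_gt0.
  have xk : 0 < x^-1 ^+ k.+1 by rewrite exprn_gt0// invr_gt0.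
  (* Each of the two integrals is at most [x^-1 ^+ k.+1 * (L 1 + L (r ^+ 2))] in absolute value,
     whence the factor 2. *)
  exists (2 * x^-1 ^+ k.+1 / `|d k.+1|); first by rewrite divr_gt0// mulr_gt0.
  move=> r; rewrite mulrAC ler_pdivlMr// -normrM -dE.
  apply: le_trans (ler_normB _ _) _.
  rewrite -mulrA mulr_natl mulr2n.
  by rewrite lerD// norm_resolvent_moment_le.
case: neqA; apply: eq_measure_resolvent_moment => // k.
exact: eqI.
Qed.

End ResolventDeterminacy.

(** * Bounded series, and coefficients of power sums that tend to 0 *)

Section Sequences.
Variable R : realType.

Lemma is_cvg_series_abs_bounded (u : R^nat) M :
  (forall N, \sum_(n < N) `|u n| <= M) -> cvgn (series u).
Proof.
move=> uM; apply: normed_cvg; apply: nondecreasing_is_cvgn.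
  by move=> m n; apply: nondecreasing_series => k _ _ /=.
exists M => _ [N _ <-]; have := uM N.
by rewrite -(big_mkord xpredT (fun n => `|u n|)).
Qed.

Lemma sum_expr_le (x : R) m N : 0 <= x <= 2^-1 ->
  \sum_(m <= j < N) x ^+ j <= 2 * x ^+ m.
Proof.
move=> /andP[x0 x1]; have [mN|Nm] := leqP m N; last first.
  by rewrite big_geq ?mulr_ge0 ?exprn_ge0// ltnW.
suff : \sum_(m <= j < N) x ^+ j <= 2 * x ^+ m - 2 * x ^+ N.
  by move/le_trans; apply; rewrite lerBlDr lerDl mulr_ge0 ?exprn_ge0.
elim: N mN => [|N IH]; first by rewrite leqn0 => /eqP ->; rewrite big_geq// subrr.
rewrite leq_eqVlt => /predU1P[->|mN]; first by rewrite big_geq// subrr.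
rewrite big_nat_recr//=; have := IH mN.
have := exprn_ge0 N x0; rewrite exprS; nra.
Qed.

(** Induction on the index [J]: the lower coefficients tend to 0, and the terms above [J] add up to
    at most [2 * M * x ^+ J.+1]. Division by [x ^+ J] leaves [|l J| <= 2 * M * x] for all small
    [x]. *)
Lemma power_sums_cvg0_coef (c : nat -> nat -> R) (l : nat -> R) (M : R) :
  (forall N j, `|c N j| <= M) ->
  (forall j, c^~ j @ \oo --> l j) ->
  (forall x : R, 0 < x <= 2^-1 ->
    (fun N => \sum_(j < N) c N j * x ^+ j) @ \oo --> (0 : R)) ->
  forall j, l j = 0.
Proof.
move=> cM cl c0; elim/ltn_ind => J IH.
have M0 : 0 <= M := le_trans (normr_ge0 _) (cM 0%N 0%N).
have key (x : R) : 0 < x <= 2^-1 -> `|l J| <= 2 * M * x.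
  move=> x01; have /andP[x0 x1] := x01.
  have xx : 0 <= x <= 2^-1 by rewrite ltW.
  have xp j : `|x ^+ j| = x ^+ j by rewrite ger0_norm// exprn_ge0// ltW.
  suff : `|l J| * x ^+ J <= 0 + 0 + 2 * M * x * x ^+ J.
    by rewrite !add0r ler_pM2r ?exprn_gt0.
  pose A N := \sum_(j < N) c N j * x ^+ j.
  pose B N := \sum_(j < J) `|c N j| * x ^+ j.
  apply: (@ler_cvg_to _ \oo _ _ (fun N => `|c N J| * x ^+ J)
     (fun N => `|A N| + B N + 2 * M * x * x ^+ J)).
  - exact: (cvgMr_tmp (cvg_norm (cl J))).
  - apply: cvgD; last exact: cvg_cst.
    apply: cvgD; first by apply/norm_cvg0P; exact: c0.
    have -> : 0 = \sum_(j < J) 0 * x ^+ j.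
      by rewrite big1// => j _; rewrite mul0r.
    apply: cvg_big => [|j _]; first exact: add_continuous.
    apply: cvgMr_tmp.
    by apply/norm_cvg0P; rewrite -(IH j (ltn_ord j)); exact: cl.
  - near=> N; have JN : (J < N)%N by near: N; exact: nbhs_infty_gt.
    have -> : `|c N J| * x ^+ J = `|c N J * x ^+ J|.
      by rewrite normrM xp.
    have AE : A N = \sum_(j < J) c N j * x ^+ j + c N J * x ^+ J
        + \sum_(J.+1 <= j < N) c N j * x ^+ j.
      rewrite /A -(big_mkord xpredT (fun j => c N j * x ^+ j)).
      by rewrite (big_cat_nat _ JN)//= big_nat_recr//= big_mkord.
    have -> : c N J * x ^+ J = A N - \sum_(j < J) c N j * x ^+ j
        - \sum_(J.+1 <= j < N) c N j * x ^+ j by rewrite AE; ring.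
    apply: le_trans (ler_normB _ _) _; apply: lerD.
      apply: le_trans (ler_normB _ _) _; rewrite lerD2l.
      apply: le_trans (ler_norm_sum _ _ _) _; apply: ler_sum => j _.
      by rewrite normrM xp.
    apply: le_trans (ler_norm_sum _ _ _) _.
    apply: (@le_trans _ _ (\sum_(J.+1 <= j < N) M * x ^+ j)).
      apply: ler_sum => j _; rewrite normrM xp.
      by rewrite ler_wpM2r// exprn_ge0// ltW.
    rewrite -mulr_sumr; have := ler_wpM2l M0 (sum_expr_le J.+1 N xx).
    move/le_trans; apply; rewrite exprS; lra.
apply/eqP; rewrite -normr_le0 leNgt; apply/negP => l0.
(* With this [d] the point [|l J| / d] is at most 1/2, and [key] there would give [d <= 2 * M],
   although [d > 4 * M]. *)
pose d := 2 * `|l J| + 4 * M.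
have d0 : 0 < d by rewrite /d; lra.
have := key (`|l J| / d); rewrite divr_gt0//= ler_pdivrMr//.
have -> : `|l J| <= 2^-1 * d by rewrite /d; lra.
move=> /(_ isT); rewrite mulrA ler_pdivlMr// /d; nra.
Unshelve. all: by end_near. Qed.

(** The sum over all pairs of indices bounds every row at once. *)
Lemma summable_row_bounded (f : nat * nat -> R) :
  summable [set: nat * nat] (fun jk => (f jk)%:E) ->
  exists M, forall j N, \sum_(k < N) `|f (j, k : nat)| <= M.
Proof.
rewrite summableE => fs.
exists (fine (\esum_(x in [set: nat * nat]) `|(f x)%:E|%E)) => j N.
rewrite -lee_fin fineK//.
pose e (k : nat) := (j, k).
rewrite (esumID (e @` [set: nat]))//.
apply: (@le_trans _ _ (\esum_(x in [set: nat * nat] `&` (e @` [set: nat])) `|(f x)%:E|)%E); last first.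
  by rewrite leeDl// esum_ge0.
rewrite setTI esum_image; last by move=> a b _ _ [].
rewrite -nneseries_esumT// -sumEFin.
apply: le_trans (nneseries_lim_ge N _) => //=.
by rewrite big_mkord.
Qed.

End Sequences.

(** * Real limits seen in the complex plane *)

Section ComplexEmbedding.
Variable R : realType.
Local Open Scope complex_scope.

Lemma norm_real_complex (x : R) : `|x%:C| = `|x|%:C.
Proof. by rewrite normc_def /= expr0n addr0 sqrtr_sqr. Qed.

Lemma cvg_real_complexP (u : R^nat) (l : R) :
  (fun n => (u n)%:C : R[i]^o) @ \oo --> (l%:C : R[i]^o) <-> u @ \oo --> l.
Proof.
split=> /cvgrPdist_lt h; apply/cvgrPdist_lt => e e0.
- have := h e%:C; rewrite ltcR => /(_ e0); apply: filterS => n.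
  by rewrite -rmorphB norm_real_complex ltcR.
(* A positive element of [R[i]] is real, so its real part serves as the radius. *)
- have eE : e = (complex.Re e)%:C.
    by case: e e0 => a b; rewrite ltcE /= => /andP[/eqP -> _].
  have e1 : 0 < complex.Re e by move: e0; rewrite {1}eE ltcR.
  have := h _ e1; apply: filterS => n.
  by rewrite -rmorphB norm_real_complex eE ltcR.
Qed.

End ComplexEmbedding.

(** * Convergence of the kernel and comparison of its coefficients *)

Section KernelExpansion.
Variables (R : realType) (s : nat -> R) (P : nat -> {poly R}).
Local Notation L := (moment_functional s).
Hypothesis size_P : forall n, size (P n) = n.+1.
Hypothesis lead_P : forall n, 0 < lead_coef (P n).
Hypothesis L_PP : forall m n, L (P m * P n) = (m == n)%:R.
Hypothesis L_ge0 : forall p : {poly R}, (forall x, 0 <= x -> 0 <= p.[x]) -> 0 <= L p.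
Hypothesis L_bound : forall x : R, 0 < x ->
  exists2 C, 0 < C & forall p : {poly R}, `|p.[- x]| <= C * (L 1 + L (p ^+ 2)).

(* The bound applied to the multiple c K of the Christoffel kernel K reads
   c K(-x) <= C (L 1 + c^2 K(-x)); take c = 1 / (2 C). *)
Lemma christoffel_bounded (x : R) : 0 < x ->
  exists M : R, forall N, \sum_(n < N) (P n).[- x] ^+ 2 <= M.
Proof.
move=> x0; have [C C0 hC] := L_bound x0.
exists (4 * C ^+ 2 * L 1) => N.
rewrite -horner_christoffel; set K := christoffel_kernel P (- x) N.
have KS : L (K ^+ 2) = K.[- x].
  by rewrite expr2 christoffel_reproducing// size_christoffel_kernel.
set S := K.[- x] in KS *.
have S0 : 0 <= S by rewrite /S horner_christoffel sumr_ge0// => i _; exact: sqr_ge0.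
have := hC ((2 * C)^-1 *: K); rewrite exprZn linearZ /= KS hornerZ -/S.
rewrite ger0_norm; last by rewrite mulr_ge0// invr_ge0 mulr_ge0// ltW.
have -> : C * (L 1 + (2 * C)^-1 ^+ 2 * S) = C * L 1 + (2 * C)^-1 * S / 2.
  by field; rewrite gt_eqF.
move=> h; have : (2 * C)^-1 * S <= 2 * C * L 1 by lra.
rewrite ler_pdivrMl ?mulr_gt0//; nra.
Qed.

(** Both factors are dominated in absolute value by [(P n).[- y]], whose squares have bounded
    sums. *)
Lemma horner_abs_bounded (y : R) : 0 < y -> exists M : R, forall N (z w : R),
  `|z| <= y -> `|w| <= y -> \sum_(n < N) `|(P n).[z] * (P n).[w]| <= M.
Proof.
move=> y0; have [M hM] := christoffel_bounded y0; exists M => N z w zy wy.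
apply: le_trans (hM N); apply: ler_sum => n _.
rewrite -(real_normK (num_real (P n).[- y])) normrM expr2.
by apply: ler_pM => //; exact: (norm_horner_orthonormal_le size_P lead_P L_PP L_ge0).
Qed.

Lemma coef_abs_bounded (t : R) : exists M : R, forall N i,
  \sum_(n < N) `|(P n)`_i * (P n).[t]| <= M.
Proof.
(* [y] has to dominate both [t] and -1, the point where [P n] bounds its own coefficients. *)
pose y : R := `|t| + 1; have y0 : 0 < y by rewrite ltr_wpDl.
have ty : `|t| <= y by rewrite lerDl.
have y1 : `|-1| <= y by rewrite normrN1 lerDr.
have [M hM] := horner_abs_bounded y0; exists M => N i.
apply: le_trans (hM N (-1) t y1 ty); apply: ler_sum => n _.
rewrite !normrM ler_wpM2r//.
exact: (norm_coef_orthonormal_le size_P lead_P L_PP L_ge0).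
Qed.

Lemma coef_sqr_bounded i : exists M : R, forall N, \sum_(n < N) (P n)`_i ^+ 2 <= M.
Proof.
have [M hM] := christoffel_bounded (@ltr01 R); exists M => N.
apply: le_trans (hM N); apply: ler_sum => n _.
rewrite -(real_normK (num_real (P n)`_i)) -[leRHS](real_normK (num_real _)).
rewrite lerXn2r ?nnegrE//.
exact: (norm_coef_orthonormal_le size_P lead_P L_PP L_ge0).
Qed.

Variable a : nat -> nat -> R.
Hypothesis a_K : entire_expansion a (kernel_fun P).
Local Open Scope complex_scope.

Lemma ceval_real (p : {poly R}) (x : R) : ceval p x%:C = (p.[x])%:C.
Proof. by rewrite /ceval horner_map. Qed.

(** At [z = 1] the powers of [z] disappear from the expansion, so one bound serves all rows. *)
Lemma coef_abs_row_bounded (t : R) : exists M : R, forall j N,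
  \sum_(k < N) `|a j k * t ^+ k| <= M.
Proof.
have [hs _] := a_K 1%:C t%:C.
have := @summable_row_bounded R (fun jk => a jk.1 jk.2 * t ^+ jk.2).
apply; apply: le_lt_trans hs; apply: le_esum => -[j k] _ /=.
rewrite -[1%:C ^+ j]rmorphXn -[t%:C ^+ k]rmorphXn -!rmorphM expr1n mulr1 /=.
by rewrite lee_fin expr0n addr0 sqrtr_sqr normr_id.
Qed.

Lemma cvg_real_expansion (x t : R) :
  (fun N => \sum_(j < N) \sum_(k < N) a j k * x ^+ j * t ^+ k) @ \oo -->
  limn (series (fun n => (P n).[x] * (P n).[t])).
Proof.
pose y : R := `|x| + `|t| + 1.
have y0 : 0 < y by rewrite ltr_wpDl// addr_ge0.
have [M hM] := horner_abs_bounded y0.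
have cK : cvgn (series (fun n => (P n).[x] * (P n).[t])).
  apply: (@is_cvg_series_abs_bounded _ _ M) => N; apply: hM.
    by rewrite /y -addrA lerDl addr_ge0.
  by rewrite /y addrAC lerDr addr_ge0.
have [_ hN] := a_K x%:C t%:C.
apply/cvg_real_complexP.
have KE : kernel_fun P x%:C t%:C = (limn (series (fun n => (P n).[x] * (P n).[t])))%:C.
  rewrite /kernel_fun; apply: cvg_lim; first exact: norm_hausdorff.
  have := (cvg_real_complexP _ _).2 cK; apply: cvg_trans.
  apply: near_eq_cvg; apply: nearW => N; rewrite /series /= rmorph_sum; apply: eq_bigr => n _.
  by rewrite !ceval_real rmorphM.
rewrite -KE; move: hN; apply: cvg_trans.
apply: near_eq_cvg; apply: nearW => N; rewrite rmorph_sum; apply: eq_bigr => j _.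
rewrite rmorph_sum; apply: eq_bigr => k _.
by rewrite !rmorphM !rmorphXn.
Qed.

(** With [t] fixed, the kernel is expanded in powers of [x] in two ways. The partial sums have a
    difference tending to 0, so [power_sums_cvg0_coef] equates the coefficients of [x ^+ i]. *)
Lemma cvg_kernel_row (t : R) i : exists l : R,
  series (fun n => (P n)`_i * (P n).[t]) @ \oo --> l /\
  series (fun k => a i k * t ^+ k) @ \oo --> l.
Proof.
have [M1 hM1] := coef_abs_bounded t.
have [M2 hM2] := coef_abs_row_bounded t.
pose u i : R^nat := series (fun n => (P n)`_i * (P n).[t]).
pose v i : R^nat := series (fun k => a i k * t ^+ k).
have cu j : cvgn (u j).
  by apply: (@is_cvg_series_abs_bounded _ _ M1) => N; exact: hM1.
have cv j : cvgn (v j).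
  by apply: (@is_cvg_series_abs_bounded _ _ M2) => N; exact: hM2.
suff uv : limn (u i) - limn (v i) = 0.
  exists (limn (u i)); split; first exact: cu.
  by move/eqP: uv; rewrite subr_eq0 => /eqP ->; exact: cv.
pose l j := limn (u j) - limn (v j); rewrite -/(l i).
apply: (@power_sums_cvg0_coef _ (fun N j => u j N - v j N) _ (M1 + M2)) => [N j|j|x _].
- apply: le_trans (ler_normB _ _) _; apply: lerD.
    apply: le_trans (hM1 N j); rewrite /u /series/= big_mkord.
    exact: ler_norm_sum.
  apply: le_trans (hM2 j N); rewrite /v /series/= big_mkord.
  exact: ler_norm_sum.
- exact: (cvgB (cu j) (cv j)).
- pose y : R := `|x| + `|t| + 1.
  have y0 : 0 < y by rewrite ltr_wpDl// addr_ge0.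
  have [M hM] := horner_abs_bounded y0.
  have cK : cvgn (series (fun n => (P n).[x] * (P n).[t])).
    apply: (@is_cvg_series_abs_bounded _ _ M) => N; apply: hM.
      by rewrite /y -addrA lerDl addr_ge0.
    by rewrite /y addrAC lerDr addr_ge0.
  have h : (fun N => series (fun n => (P n).[x] * (P n).[t]) N -
      \sum_(j < N) \sum_(k < N) a j k * x ^+ j * t ^+ k) @ \oo --> (0 : R).
    rewrite -[X in _ --> X](subrr (limn (series (fun n => (P n).[x] * (P n).[t])))).
    exact: (cvgB cK (@cvg_real_expansion x t)).
  apply: cvg_trans h; apply: near_eq_cvg; apply: nearW => N /=; rewrite /series /= big_mkord.
  under [RHS]eq_bigr do rewrite mulrBl.
  rewrite sumrB; congr (_ - _).
    under [RHS]eq_bigr do rewrite /u /series/= big_mkord mulr_suml.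
    rewrite exchange_big; apply: eq_bigr => n _ /=.
    (* [n < N] puts the degree of [P n] below [N], so the sum over [j < N] misses none of its
       coefficients. *)
    rewrite (@horner_coef_wide _ N) ?size_P ?ltn_ord// mulr_suml.
    by apply: eq_bigr => j _; rewrite mulrAC.
  apply: eq_bigr => j _; rewrite /v /series/= big_mkord mulr_suml.
  by apply: eq_bigr => k _; rewrite mulrAC.
Qed.

End KernelExpansion.

(** * Integration term by term, and orthogonal series in the square mean *)

Section Termwise.
Variables (R : realType) (s : nat -> R)
  (nu : {measure set (measurableTypeR R) -> \bar R}).
Hypothesis nu_s : stieltjes_solution s nu.
Local Notation H := (`[0, +oo[%classic : set (measurableTypeR R)).
Local Notation L := (moment_functional s).

Lemma measurable_horner (p : {poly R}) (D : set (measurableTypeR R)) :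
  measurable D -> measurable_fun D (fun t => p.[t]).
Proof.
move=> mD; apply: measurable_funS (measurableT) _ _ => //.
by apply: continuous_measurable_fun; exact: continuous_horner.
Qed.

Lemma integral_horner_half_line (p : {poly R}) :
  (\int[nu]_(t in H) (p.[t])%:E = (L p)%:E)%E.
Proof.
rewrite -(integral_half_line nu_s (integrable_horner nu_s p)).
exact: (integral_poly_moment nu_s).
Qed.

Lemma moment_ge0 n : 0 <= s n.
Proof.
rewrite -(moment_functionalXn s); apply: (moment_functional_ge0 nu_s) => x x0.
by rewrite hornerXn exprn_ge0.
Qed.

(** The moments being nonnegative, absolute convergence makes [g t], the sum of the
    [|c k * t ^+ (k + j)|], integrable; [g] dominates all partial sums. *)
Lemma cvg_integral_termwise (c : R^nat) (F : R -> R) j :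
  cvgn [normed series (fun k => c k * s (k + j)%N)] ->
  (forall t, 0 <= t -> series (fun k => c k * t ^+ k) @ \oo --> F t) ->
  nu.-integrable H (fun t => (t ^+ j * F t)%:E) /\
  series (fun k => c k * s (k + j)%N) @ \oo --> \int[nu]_(t in H) (t ^+ j * F t).
Proof.
move=> cs cF.
pose h k t : \bar R := (`|c k * t ^+ (k + j)|)%:E.
have h0 k t : (0 <= h k t)%E by rewrite lee_fin.
have mh k : measurable_fun H (h k).
  apply/measurable_EFinP; apply: measurableT_comp => //.
  apply: eq_measurable_fun (@measurable_horner (c k *: 'X^(k + j)) _ (@measurable_half_line R)).
  by move=> t _; rewrite hornerZ hornerXn.
have int_h k : (\int[nu]_(t in H) h k t = (`|c k * s (k + j)%N|)%:E)%E.
  rewrite normrM (ger0_norm (moment_ge0 _)) -(moment_functionalXn s).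
  have -> : `|c k| * L 'X^(k + j) = L (`|c k| *: 'X^(k + j)) by rewrite linearZ.
  rewrite -integral_horner_half_line; apply: eq_integral => t.
  rewrite inE /= in_itv/= andbT => t0.
  by rewrite /h hornerZ hornerXn normrM [`|t ^+ _|]ger0_norm// exprn_ge0.
pose g t := (\sum_(k <oo) h k t)%E.
have mg : measurable_fun H g.
  by apply: ge0_emeasurable_sum => // k t _ _; exact: h0.
have g0 t : (0 <= g t)%E by apply: nneseries_ge0 => k _ _; exact: h0.
have ig : nu.-integrable H g.
  apply/integrableP; split => //.
  under eq_integral do rewrite gee0_abs//.
  rewrite /g integral_nneseries//.
  under eq_eseriesr do rewrite int_h.
  have -> : (\sum_(k <oo) (`|c k * s (k + j)%N|)%:E)%E =
      (limn [normed series (fun k => c k * s (k + j)%N)])%:E.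
    rewrite -EFin_lim//; congr (limn _); apply/funext => n /=.
    by rewrite sumEFin.
  by rewrite ltry.
pose p N : {poly R} := 'X^j * \sum_(k < N) c k *: 'X^k.
have pE N t : (p N).[t] = t ^+ j * series (fun k => c k * t ^+ k) N.
  rewrite /p hornerM hornerXn horner_sum /series/= big_mkord.
  by congr (_ * _); apply: eq_bigr => k _; rewrite hornerZ hornerXn.
have Lp N : L (p N) = series (fun k => c k * s (k + j)%N) N.
  rewrite /p mulr_sumr linear_sum /series/= big_mkord; apply: eq_bigr => k _.
  by rewrite -scalerAr -exprD linearZ /= moment_functionalXn addnC.
have cvg_p t : 0 <= t -> (fun N => (p N).[t]) @ \oo --> t ^+ j * F t.
  by move=> t0; under eq_fun do rewrite pE; apply: cvgMl_tmp; exact: cF.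
have [] := @dominated_convergence _ _ _ nu H (@measurable_half_line R)
  (fun N t => ((p N).[t])%:E) (fun t => (t ^+ j * F t)%:E) g _ _ _ ig _.
- by move=> N; apply/measurable_EFinP; exact: measurable_horner.
- apply/measurable_EFinP; apply: (@measurable_fun_cvg _ _ _ _ (fun N t => (p N).[t])).
    by move=> N; exact: measurable_horner.
  by move=> t; rewrite /= in_itv/= andbT; exact: cvg_p.
- apply: aeW => t /=; rewrite in_itv/= andbT => t0; apply: cvg_EFin.
    exact: nearW.
  exact: cvg_p.
- apply: aeW => t N /=; rewrite in_itv/= andbT => t0.
  apply: le_trans (nneseries_lim_ge N _); last by move=> k _ _; exact: h0.
  rewrite big_mkord sumEFin lee_fin pE /series/= big_mkord mulr_sumr.
  apply: le_trans (ler_norm_sum _ _ _) _; apply: ler_sum => k _.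
  by rewrite mulrCA -exprD addnC.
move=> iF _ hlim; split => //.
rewrite -(@fineK _ (\int[nu]_(t in H) (t ^+ j * F t)%:E)%E) in hlim; last first.
  exact: integrable_fin_num.
apply: cvg_trans (fine_cvg hlim); apply: near_eq_cvg; apply: nearW => N /=.
by rewrite integral_horner_half_line Lp.
Qed.

Variable P : nat -> {poly R}.
Hypothesis L_PP : forall m n, L (P m * P n) = (m == n)%:R.
Variables (u : R^nat) (M : R) (F : R -> R).
Hypothesis u_bounded : forall N, \sum_(n < N) u n ^+ 2 <= M.
Hypothesis u_F : forall t, 0 <= t ->
  series (fun n => u n * (P n).[t]) @ \oo --> F t.

Let S N : {poly R} := \sum_(n < N) u n *: P n.
Let beta := series (fun n => u n ^+ 2).

Let S_F t : 0 <= t -> (fun N => (S N).[t]) @ \oo --> F t.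
Proof.
move=> t0; have := u_F t0; apply: cvg_trans; apply: near_eq_cvg; apply: nearW => N.
rewrite /S horner_sum /series/= big_mkord; apply: eq_bigr => n _.
by rewrite hornerZ.
Qed.

(** Pythagoras: each new term [u n *: P n] is orthogonal to the earlier partial sums. *)
Lemma moment_functional_sqr_partial_sumB N m :
  L ((S (N + m) - S N) ^+ 2) = beta (N + m)%N - beta N.
Proof.
have PS k n : (k <= n)%N -> L (P n * S k) = 0.
  move=> kn; rewrite /S mulr_sumr linear_sum big1// => i _.
  rewrite -scalerAr linearZ /= L_PP gtn_eqF ?mulr0//.
  exact: leq_trans (ltn_ord i) kn.
elim: m => [|m IH]; first by rewrite addn0 !subrr expr0n linear0.
have -> : S (N + m.+1) = S (N + m) + u (N + m)%N *: P (N + m)%N.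
  by rewrite addnS /S big_ord_recr.
have -> : beta (N + m.+1)%N = beta (N + m)%N + u (N + m)%N ^+ 2.
  by rewrite addnS /beta /series/= big_nat_recr.
rewrite addrAC sqrrD; set D := S (N + m) - S N in IH *.
have PD : L (P (N + m)%N * D) = 0.
  by rewrite /D mulrBr linearB /= !PS ?leq_addr// subrr.
rewrite [D * _]mulrC -scalerAl exprZn !linearD /= !linearZ /= IH PD.
rewrite [P _ ^+ 2]expr2 L_PP eqxx mulr1; ring.
Qed.

Let beta_cvg : cvgn beta.
Proof.
apply: (@is_cvg_series_abs_bounded _ _ M) => N.
by apply: le_trans (u_bounded N); apply: ler_sum => n _; rewrite ger0_norm ?sqr_ge0.
Qed.

Let beta_le N : beta N <= limn beta.
Proof.
apply: nondecreasing_cvgn_le => // a b ab.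
by apply: nondecreasing_series ab => n _ _; exact: sqr_ge0.
Qed.

Let mF : measurable_fun H F.
Proof.
apply: (@measurable_fun_cvg _ _ _ _ (fun N t => (S N).[t])).
  by move=> N; exact: measurable_horner.
by move=> t; rewrite /= in_itv/= andbT; exact: S_F.
Qed.

(** Fatou's lemma for the squares of [S (N + m) - S N] as [m] grows. The pointwise limit [F] is
    thereby also the limit in the square mean. *)
Lemma integral_sqr_remainder_le N :
  (\int[nu]_(t in H) ((F t - (S N).[t]) ^+ 2)%:E <= (limn beta - beta N)%:E)%E.
Proof.
pose f m t : \bar R := (((S (N + m) - S N) ^+ 2).[t])%:E.
have mf m : measurable_fun H (f m).
  by apply/measurable_EFinP; exact: measurable_horner.
have f0 m t : H t -> (0 <= f m t)%E.
  by move=> _; rewrite lee_fin horner_exp sqr_ge0.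
have -> : (\int[nu]_(t in H) ((F t - (S N).[t]) ^+ 2)%:E =
    \int[nu]_(t in H) limn_einf (f ^~ t))%E.
  apply: eq_integral => t; rewrite inE/= in_itv/= andbT => t0.
  have h : f ^~ t @ \oo --> ((F t - (S N).[t]) ^+ 2)%:E.
    apply: cvg_EFin; first exact: nearW.
    have -> : fine \o f ^~ t = (fun m => ((S (m + N)).[t] - (S N).[t]) ^+ 2).
      by apply/funext => m; rewrite /= horner_exp hornerD hornerN addnC.
    have hS : (fun m => (S (m + N)).[t]) @ \oo --> F t.
      by rewrite (cvg_shiftn N (fun N => (S N).[t])); exact: S_F.
    by apply: cvgM; apply: cvgB => //; exact: cvg_cst.
  by rewrite (cvg_limn_einf_sup h).1.
apply: le_trans (@fatou _ _ _ nu H (@measurable_half_line R) f mf f0) _.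
(* The lower limit is the limit of the infima of the tails, each at most the first integral of its
   tail. *)
rewrite limn_einf_lim; apply: lime_le; first exact: is_cvg_einfs.
apply: nearW => m; apply: (@le_trans _ _ (\int[nu]_(t in H) f m t)%E).
  by apply: ereal_inf_lbound; exists m => //=.
rewrite integral_horner_half_line moment_functional_sqr_partial_sumB lee_fin.
by rewrite lerD2r.
Qed.

(** [F - S N] tends to 0 in the square mean, and integration against [q] is continuous for it. *)
Lemma cvg_integral_orthogonal_series (q : {poly R}) :
  nu.-integrable H (fun t => (q.[t] * F t)%:E) ->
  (fun N => L (q * S N)) @ \oo --> \int[nu]_(t in H) (q.[t] * F t).
Proof.
move=> iqF.
have mD N : measurable_fun H (fun t => F t - (S N).[t]).
  by apply: measurable_funB; [exact: mF|exact: measurable_horner].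
have iD2 N : nu.-integrable H (fun t => ((F t - (S N).[t]) ^+ 2)%:E).
  apply/integrableP; split.
    by apply/measurable_EFinP; apply: measurable_funX.
  under eq_integral do rewrite gee0_abs ?lee_fin ?sqr_ge0//.
  by apply: le_lt_trans (integral_sqr_remainder_le N) _; rewrite ltry.
have D2 N : \int[nu]_(t in H) ((F t - (S N).[t]) ^+ 2) <= limn beta - beta N.
  rewrite -lee_fin /Rintegral fineK; first exact: integral_sqr_remainder_le.
  exact: integrable_fin_num.
have q2 : 0 <= L (q ^+ 2).
  apply: (moment_functional_ge0 nu_s) => t _; rewrite horner_exp; exact: sqr_ge0.
(* AM-GM: [|q D| <= (d q^2 + D^2 / d) / 2] with [D = F - S_N] *)
have key d N : 0 < d -> `|\int[nu]_(t in H) (q.[t] * F t) - L (q * S N)| <=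
    2^-1 * (d * L (q ^+ 2) + d^-1 * (limn beta - beta N)).
  move=> d0; rewrite -(Rintegral_horner nu_s).
  rewrite -RintegralB//; last exact: (integrable_horner_half_line nu_s).
  have iqD : nu.-integrable H (fun t => (q.[t] * F t - (q * S N).[t])%:E).
    exact: (integrableB (@measurable_half_line R) iqF (integrable_horner_half_line nu_s (q * S N))).
  apply: le_trans (le_normr_Rintegral _ iqD) _ => //.
  have i1 : nu.-integrable H (fun t => (((2^-1 * d) *: q ^+ 2).[t])%:E).
    exact: (integrable_horner_half_line nu_s).
  have i2 : nu.-integrable H (fun t => ((2^-1 * d^-1) * (F t - (S N).[t]) ^+ 2)%:E).
    exact: (integrableZl (@measurable_half_line R) (2^-1 * d^-1) (iD2 N)).
  apply: (@le_trans _ _ (\int[nu]_(t in H)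
     (((2^-1 * d) *: q ^+ 2).[t] + (2^-1 * d^-1) * (F t - (S N).[t]) ^+ 2))).
    apply: le_Rintegral => //.
    - by have /integrable_norm := iqD.
    - exact: (integrableD (@measurable_half_line R) i1 i2).
    - move=> t _; rewrite hornerZ horner_exp hornerM -mulrBr normrM.
      rewrite -(real_normK (num_real q.[t])) -(real_normK (num_real (F t - (S N).[t]))).
      move: `|q.[t]| `|F t - (S N).[t]| => x y.
      rewrite -subr_ge0.
      have -> : 2^-1 * d * x ^+ 2 + 2^-1 * d^-1 * y ^+ 2 - x * y =
          2^-1 * d^-1 * (d * x - y) ^+ 2 by field; rewrite gt_eqF.
      by rewrite mulr_ge0 ?sqr_ge0// mulr_ge0// invr_ge0 ltW.
  rewrite RintegralD// (Rintegral_horner nu_s) linearZ /=.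
  rewrite RintegralZl; [|by []|exact: iD2].
  rewrite mulrDr [2^-1 * (d * _)]mulrA lerD2l mulrA ler_wpM2l//.
  by rewrite mulr_ge0// invr_ge0 ltW.
apply/cvgrPdist_le => e e0.
(* This makes [d * L (q ^+ 2)] at most [e], the added 1 keeping the denominator positive; a large
   [N] then brings the remainder below [d * e]. *)
pose d := e / (L (q ^+ 2) + 1).
have q20 : 0 < L (q ^+ 2) + 1 by rewrite ltr_wpDl.
have d0 : 0 < d by rewrite divr_gt0.
have /cvgrPdist_le/(_ (d * e)) := beta_cvg; rewrite mulr_gt0// => /(_ isT).
apply: filterS => N hN; apply: le_trans (key d N d0) _.
have h1 : d * L (q ^+ 2) <= e.
  by rewrite /d mulrAC ler_pdivrMr// ler_pM2l// lerDl.
have h2 : d^-1 * (limn beta - beta N) <= e.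
  by rewrite ler_pdivrMl// (le_trans (ler_norm _)).
lra.
Qed.

End Termwise.

(** This is the coefficient of degree [i] in the expansion of ['X^j] in the basis [P], exact as soon
    as [j < N]. *)
Lemma moment_functional_Xn_coef (R : realFieldType) (s : nat -> R) (P : nat -> {poly R}) :
  (forall n, size (P n) = n.+1) -> (forall n, 0 < lead_coef (P n)) ->
  (forall m n, moment_functional s (P m * P n) = (m == n)%:R) ->
  forall i j N, (j < N)%N ->
  moment_functional s ('X^j * \sum_(n < N) (P n)`_i *: P n) = (i == j)%:R.
Proof.
move=> size_P lead_P L_PP i j N jN.
have := @orthonormal_expansion _ s P size_P lead_P L_PP N 'X^j.
rewrite size_polyXn => /(_ jN)/(congr1 (fun p : {poly R} => p`_i)).
rewrite coefXn => ->; rewrite coef_sum mulr_sumr linear_sum; apply: eq_bigr => n _.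
by rewrite coefZ -scalerAr linearZ /= mulrC.
Qed.

(** * The equivalence: one row of the kernel, times a power of [t], integrated in two ways *)

Unset Implicit Arguments.

Theorem proposition2p4 (R : realType)
    (nu : probability (measurableTypeR R) R) (s : nat -> R)
    (P : nat -> {poly R}) (a : nat -> nat -> R)
    (nu_half_line : on_half_line nu)
    (nu_support : infinite_set (measure_support nu))
    (nu_moments : has_moments nu s)
    (nu_indeterminate : indeterminate s nu)
    (P_orthonormal : orthonormal_polynomials nu P)
    (a_coefficients : entire_expansion a (kernel_fun P)) :
  prop_ac a s <-> prop_aci a s.
Proof.
split=> [ac|[]//]; split => // i j.
have nu_s : stieltjes_solution s nu by [].
have [P_size P_int] := P_orthonormal.
have size_P n : size (P n) = n.+1 := (P_size n).1.
have lead_P n : 0 < lead_coef (P n) := (P_size n).2.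
have L_PP m n : moment_functional s (P m * P n) = (m == n)%:R.
  apply: EFin_inj; rewrite -(integral_poly_moment nu_s) -P_int.
  by apply: eq_integral => t _; rewrite hornerM.
have L_ge0 := @moment_functional_ge0 R s nu nu_s.
have [mu [mu_s [A mA neqA]]] := nu_indeterminate.
have L_bound x (x0 : 0 < x) := point_evaluation_bound x0 mu_s nu_s mA neqA.
have row t k := cvg_kernel_row size_P lead_P L_PP L_ge0 L_bound a_coefficients t k.
(* [F] is the common limit of the power series of row [i] and of the orthogonal series whose
   coefficients are those of degree [i] in the [P n]. *)
pose F t := limn (series (fun k => a i k * t ^+ k)).
have a_F t : series (fun k => a i k * t ^+ k) @ \oo --> F t.
  by have [l [_ hl]] := row t i; rewrite /F (cvg_lim _ hl).
have P_F t : series (fun n => (P n)`_i * (P n).[t]) @ \oo --> F t.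
  by have [l [hl hl']] := row t i; rewrite /F (cvg_lim _ hl').
have [M hM] := coef_sqr_bounded size_P lead_P L_PP L_ge0 L_bound i.
(* Property (ac) enters here, as the absolute convergence behind termwise integration. *)
have [iF hF] := cvg_integral_termwise nu_s (ac i j) (fun t _ => a_F t).
suff <- : \int[nu]_(t in `[0, +oo[%classic) (t ^+ j * F t) = (i == j)%:R by [].
have iXF : nu.-integrable `[0, +oo[%classic (fun t => (('X^j).[t] * F t)%:E).
  by apply: eq_integrable iF => // t _; rewrite hornerXn.
have hX := cvg_integral_orthogonal_series nu_s L_PP hM (fun t _ => P_F t) iXF.
transitivity (\int[nu]_(t in `[0, +oo[%classic) (('X^j).[t] * F t)).
  by apply: eq_Rintegral => t _; rewrite hornerXn.
(* The approximating values converging to this integral are constant from [N = j.+1] on. *)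
apply: (cvg_unique _ hX); first exact: norm_hausdorff.
apply: cvg_near_cst; exists j.+1 => // N /= jN.
exact: moment_functional_Xn_coef size_P lead_P L_PP _ _ _ jN.
Qed.
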